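(* Let $G$ be a connected, locally finite chordal graph and let $T$ be a spanning tree of the clique graph $\mathcal{C}(G)$. Then $T$ is a clique tree of $G$ if and only if for every finite clique family $F$ of $G$, $$T[F]\in\operatorname{argmax}\{w(S): S \text{ a spanning tree of } \mathcal{C}(G)[F]\}.$$
   Context: A chordal graph is a loopless graph without multiple edges with no induced cycle of length greater than $3$; chordal graphs are assumed connected; locally finite means all degrees finite. A clique is a maximal complete vertex set; $\mathcal{K}(G)$ is the set of cliques. The clique graph $\mathcal{C}(G)$ has vertex set $\mathcal{K}(G)$ and an edge between distinct intersecting cliques. A clique tree is a spanning tree $T$ of $\mathcal{C}(G)$ such that for every vertex $v$ the subgraph of $T$ induced by the cliques containing $v$ is a tree. A clique family is a set of the form $F(C)=\{K\in\mathcal{K}(G):C\subseteq K\}$ for a complete (possibly empty) vertex set $C$. $H[F]$ denotes the induced subgraph on $F$. Edge weights: $w(K_1K_2):=|K_1\cap K_2|$, and for a subgraph $S$, $w(S):=\sum_{K_1K_2\in S}w(K_1K_2)$. *)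

(* Defs.v *)
From HB Require Import structures.
From mathcomp Require Import all_boot finmap.
From mathcomp Require Import boolp classical_sets functions cardinality fsbigop.

Set Implicit Arguments.
Unset Strict Implicit.
Unset Printing Implicit Defensive.

Local Open Scope classical_set_scope.

(* Simple graphs, possibly infinite: the vertex set is a subset of the ambient
   type so that a graph, its clique graph and all their subgraphs are objects
   of the same kind. *)
Record graph (T : eqType) := Graph {
  vset : set T;
  edge : rel T;
  edge_sym : symmetric edge;
  edge_irr : irreflexive edge;
  edge_vset : forall x y, edge x y -> vset x
}.

Section Graphs.
Variable T : eqType.
Implicit Types (H S : graph T) (A : set T) (c : seq T).

Definition locally_finite H := forall x, vset H x -> finite_set [set y | edge H x y].

Definition connected H :=
  vset H !=set0 /\
  forall x y, vset H x -> vset H y ->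
    exists2 p, path (edge H) x p & last x p = y.

Definition acyclic H := forall c, 2 < size c -> ~ ucycle (edge H) c.

Definition tree H := connected H /\ acyclic H.

Definition induced_cycle H c :=
  ucycle (edge H) c /\
  forall x y, x \in c -> y \in c -> edge H x y -> y = next c x \/ x = next c y.

Definition chordal H := forall c, 3 < size c -> ~ induced_cycle H c.

Definition subgraph S H :=
  vset S `<=` vset H /\ forall x y, edge S x y -> edge H x y.

Definition spanning_tree H S :=
  [/\ subgraph S H, vset S = vset H & tree S].

Definition induced_edge H A : rel T :=
  [rel x y | [&& edge H x y, x \in A & y \in A]].

Lemma induced_edge_sym H A : symmetric (induced_edge H A).
Proof. by move=> x y; rewrite /induced_edge /= edge_sym; congr andb; rewrite andbC. Qed.

Lemma induced_edge_irr H A : irreflexive (induced_edge H A).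
Proof. by move=> x; rewrite /induced_edge /= edge_irr. Qed.

Lemma induced_edge_vset H A x y : induced_edge H A x y -> (vset H `&` A) x.
Proof. by case/and3P=> /edge_vset Hx /set_mem Ax _; split. Qed.

Definition induced H A : graph T :=
  Graph (@induced_edge_sym H A) (@induced_edge_irr H A)
        (@induced_edge_vset H A).

End Graphs.

Section CliqueGraph.
Variable T : eqType.
Implicit Types (H : graph T) (A K L : set T).

Definition edge_set H : set (set T) :=
  [set e | exists x y, edge H x y /\ e = [set x; y]].

Definition complete H A :=
  A `<=` vset H /\ forall x y, A x -> A y -> x != y -> edge H x y.

Definition cliques H : set (set T) :=
  [set K | complete H K /\ forall L, complete H L -> K `<=` L -> L = K].

Definition clique_edge H : rel (set T) :=
  [rel K L | [&& K \in cliques H, L \in cliques H, K != L & K `&` L != set0]].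

Lemma clique_edge_sym H : symmetric (clique_edge H).
Proof. by move=> K L; rewrite /clique_edge /= andbCA (eq_sym K L) (setIC K L). Qed.

Lemma clique_edge_irr H : irreflexive (clique_edge H).
Proof. by move=> K; rewrite /clique_edge /= eqxx /= !andbF. Qed.

Lemma clique_edge_vset H K L : clique_edge H K L -> cliques H K.
Proof. by move=> /andP[/set_mem]. Qed.

Definition clique_graph H : graph (set T) :=
  Graph (@clique_edge_sym H) (@clique_edge_irr H) (@clique_edge_vset H).

Definition clique_tree H (S : graph (set T)) :=
  spanning_tree (clique_graph H) S /\
  forall v, vset H v -> tree (induced S [set K | cliques H K /\ K v]).

Definition clique_family H A : set (set T) :=
  [set K | cliques H K /\ A `<=` K].

Definition clique_families H : set (set (set T)) :=
  [set F | exists2 A, complete H A & F = clique_family H A].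

End CliqueGraph.

(* An edge K1K2 is the unordered pair [set K1; K2], whose intersection is
   K1 `&` K2 (edge_weight_pair).  On infinite sets fset_set is empty, and a sum
   with infinitely many nonzero terms is 0. *)
Definition edge_weight (V : choiceType) (e : set (set V)) : nat :=
  #|` fset_set (\bigcap_(K in e) K)|.

Lemma edge_weight_pair (V : choiceType) (K1 K2 : set V) :
  edge_weight [set K1; K2] = #|` fset_set (K1 `&` K2)|.
Proof. by rewrite /edge_weight bigcap_setU !bigcap_set1. Qed.

Definition weight (V : choiceType) (S : graph (set V)) : nat :=
  \big[addn/0]_(e \in edge_set S) edge_weight e.

Definition argmax (X : Type) (P : set X) (f : X -> nat) : set X :=
  [set x | P x /\ forall y, P y -> f y <= f x].

(* Main.v *)
(* Writing [#|K `&` L|] as a sum over vertices turns [weight S] into the sum over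
   [v] of the number of edges of [S] between the cliques of the family that
   contain [v]. A forest on [n > 0] vertices has at most [n - 1] edges and a
   connected graph at least [n - 1], so a spanning tree whose cliques at every
   vertex are connected maximises every term at once; the families of a clique
   tree are connected because intersections of subtrees are. Conversely, the
   family of a single vertex is finite, and membership in the argmax already says
   that it induces a tree. *)
Require Import Defs.
From HB Require Import structures.
From mathcomp Require Import all_boot finmap.
From mathcomp Require Import boolp classical_sets functions cardinality fsbigop.

Set Implicit Arguments.
Unset Strict Implicit.
Unset Printing Implicit Defensive.

Local Open Scope classical_set_scope.

(** * Paths, crossing edges and uniqueness of paths in acyclic graphs *)

Section Paths.
Variable T : eqType.
Implicit Types (H : graph T) (A : set T) (x y : T) (p q s : seq T).

Lemma edge_vset_r H x y : edge H x y -> vset H y.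
Proof. by rewrite edge_sym => /edge_vset. Qed.

Lemma path_crossing H x p s : path (edge H) x p -> x \in s -> last x p \notin s ->
  exists a b, [/\ a \in s, b \notin s & edge H a b].
Proof.
elim: p x => [|y p IHp] x /=; first by move=> _ ->.
case/andP=> exy py xs; have [ys|nys] := boolP (y \in s); first exact: IHp.
by move=> _; exists x, y.
Qed.

Lemma path_induced H A x p : path (edge (induced H A)) x p ->
  path (edge H) x p /\ (x \in A -> all [in A] (x :: p)).
Proof.
elim: p x => [|y p IHp] x /=; first by move=> _; split=> // ->.
by case/andP=> /and3P[exy -> yA] /IHp[-> /(_ yA) /= ->]; rewrite exy.
Qed.

Lemma induced_path H A x p : path (edge H) x p -> all [in A] (x :: p) ->
  path (edge (induced H A)) x p.
Proof.
elim: p x => [//|y p IHp] x /= /andP[exy py] /and3P[xA yA pA].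
by rewrite /induced_edge /= exy xA yA IHp //= yA.
Qed.

Lemma acyclic_subgraph H S : subgraph S H -> acyclic H -> acyclic S.
Proof.
move=> [_ SH] acH c sc /andP[cyc uc]; apply: (acH c sc); rewrite /ucycle uc andbT.
by apply: sub_cycle cyc => x y; apply: SH.
Qed.

Lemma acyclic_path_inj H x p q : acyclic H ->
  path (edge H) x p -> path (edge H) x q ->
  uniq (x :: p) -> uniq (x :: q) -> last x p = last x q -> p = q.
Proof.
move=> acH; elim: p q x => [|a p IHp] [|b q] x //.
- by move=> _ _ _ /= /andP[/negP xq _] xl; case: xq; rewrite {1}xl mem_last.
- by move=> _ _ /= /andP[/negP xq _] _ xl; case: xq; rewrite -{1}xl mem_last.
move=> pp pq up uq lpq; have [ab|ab] := eqVneq a b.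
  move: pp pq up uq lpq; rewrite -ab /=.
  move=> /andP[_ pp] /andP[_ pq] /andP[_ up] /andP[_ uq] lpq.
  by congr cons; apply: (IHp q a).
(* Closing the two branches at the first vertex of [p] on [q] gives a cycle. *)
have [P defP] : exists P, P = a :: p by eexists.
have [Q defQ] : exists Q, Q = b :: q by eexists.
have hq : has [in Q] P.
  apply/hasP; exists (last x P); first by rewrite defP /= mem_last.
  by rewrite defP lpq defQ /= mem_last.
move: pp pq up uq; rewrite -defP -defQ.
case: (split_find hq) defP => z p1 p2 zq np1 defP.
case/splitPr: zq np1 defQ {hq} => [q1 q2] np1 defQ.
rewrite cat_path => /andP[pp _] ; rewrite -cat_rcons cat_path => /andP[pq _].
rewrite -!cat_cons !cat_uniq => /andP[up _] /andP[uq _].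
exfalso; apply: (acH (x :: rcons p1 z ++ rev q1)).
  (* The cycle has at least three vertices: [p1] and [q1] both empty would give [a = z = b]. *)
  case: p1 q1 {np1 pp pq up uq} defP defQ => [|? p1] [|? q1] [? _] [? _].
  - by case/eqP: ab; congruence.
  - by rewrite /= size_rev.
  - by rewrite /= size_cat size_rcons.
  - by rewrite /= size_cat size_rcons.
rewrite /ucycle; apply/andP; split.
  rewrite /= rcons_path cat_path pp last_rcons /=.
  (* Reversed, the branch from [x] through [q1] to [z] leads from [z] back to [x]. *)
  move: (rev_path (edge H) x (rcons q1 z)).
  rewrite last_rcons belast_rcons rev_cons rcons_path.
  rewrite (eq_path (e' := edge H)); last by move=> ? ?; rewrite edge_sym.
  by rewrite pq last_cat last_rcons => /andP[-> ->].
rewrite -cat_cons cat_uniq up rev_uniq /=.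
move: uq; rewrite /= rcons_uniq mem_rcons inE negb_or => /and3P[/andP[_ xq] zq ->].
rewrite andbT; apply/hasPn => y; rewrite mem_rev => yq.
rewrite inE mem_rcons inE !negb_or.
apply/and3P; split; [by apply: contraNneq xq => <-|by apply: contraNneq zq => <-|].
by apply: contra np1 => yp; apply/hasP; exists y; rewrite // mem_cat yq.
Qed.

(** * Edge counts of forests and of connected graphs *)

Lemma acyclic_leaf H s : acyclic H -> uniq s -> s != [::] ->
  exists2 x, x \in s & count (edge H x) s <= 1.
Proof.
move=> acH us; case def_s: s => [//|x0 s0] _; rewrite -def_s.
have x0s : x0 \in s by rewrite def_s mem_head.
(* The leaf is the head of a longest path inside [s]: by maximality all its neighbours in [s] lie on
   the path, and one beyond the second vertex would close a cycle. *)
pose P n := `[< exists x p,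
  [/\ path (edge H) x p, uniq (x :: p), {subset x :: p <= s} & size p = n] >].
have exP : exists n, P n.
  by exists 0; apply/asboolP; exists x0, [::]; split=> // y; rewrite inE => /eqP->.
have ubP n : P n -> n <= size s.
  by move=> /asboolP[x [p [_ /andP[_ up] ps <-]]]; apply: uniq_leq_size up _ => y yp;
     apply: ps; rewrite inE yp orbT.
case: (ex_maxnP exP ubP) => n /asboolP[x [p [pp up ps sp]]] maxn.
exists x; first exact/ps/mem_head.
have onpath y : y \in s -> edge H x y -> y \in p.
  move=> ys exy; apply: contraT => yp.
  suff /maxn : P n.+1 by rewrite ltnn.
  apply/asboolP; exists y, (x :: p); split=> /=; rewrite ?sp //.
  - by rewrite edge_sym exy.
  - rewrite -/(uniq (x :: p)) up andbT inE negb_or yp andbT.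
    by apply: contraTneq exy => ->; rewrite edge_irr.
  - by move=> z; rewrite inE => /predU1P[->|/ps].
have onhead y : y \in s -> edge H x y -> y == head x p.
  move=> ys exy; apply: contraT => yh; case/splitPr: (onpath y ys exy) pp up yh => p1 p2.
  rewrite -cat_rcons -cat_cons cat_path cat_uniq => /andP[pp _] /andP[up _] yh.
  exfalso; apply: (acH (x :: rcons p1 y)).
    by case: p1 yh {pp up} => [|? p1]; rewrite /= ?eqxx // size_rcons.
  by rewrite /ucycle up /= rcons_path pp last_rcons edge_sym exy.
rewrite -size_filter; apply: (@leq_trans (size [:: head x p])) => //.
apply: uniq_leq_size; first exact: filter_uniq.
by move=> y; rewrite mem_filter inE => /andP[exy ys]; apply: onhead.
Qed.

(** Twice the number of edges inside [s] when [s] has no repetition, since each edge is met in both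
    orders. *)
Definition degree_sum H s := \sum_(x <- s) \sum_(y <- s) edge H x y.

Lemma degree_sum_cons H x s :
  degree_sum H (x :: s) = (count (edge H x) s).*2 + degree_sum H s.
Proof.
have <- : \sum_(y <- s) edge H x y = count (edge H x) s.
  by rewrite -sumn_count sumnE big_map.
rewrite /degree_sum big_cons big_cons edge_irr add0n.
under [X in _ + X]eq_bigr do rewrite big_cons edge_sym.
by rewrite big_split /= -addnn -addnA.
Qed.

Lemma perm_degree_sum H s t : perm_eq s t -> degree_sum H s = degree_sum H t.
Proof.
move=> st; rewrite /degree_sum (perm_big _ st) /=.
by apply: eq_bigr => x _; apply: perm_big.
Qed.

(** Leaves are removed one at a time, each taking away at most 2. *)
Lemma degree_sum_acyclic H s : acyclic H -> uniq s ->
  degree_sum H s <= (size s).-1.*2.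
Proof.
move=> acH; have [n] := ubnP (size s); elim: n s => // n IHn s sn us.
have [->|sN0] := eqVneq s [::]; first by rewrite /degree_sum big_nil.
have [x xs dx] := acyclic_leaf acH us sN0.
rewrite (perm_degree_sum H (perm_to_rem xs)) degree_sum_cons.
have := perm_size (perm_to_rem xs) => /= ss.
(* When [x] is the only vertex left, [(size s).-1] does not drop on its removal, so the degree bound
   must be 0 rather than 1. *)
have dx' : count (edge H x) (rem x s) <= (0 < size (rem x s)).
  have := permP (perm_to_rem xs) (edge H x); rewrite /= edge_irr add0n => <-.
  case: (rem x s) (perm_to_rem xs) => [|//] /(permP (s1 := _)) -> /=.
  by rewrite edge_irr.
have {IHn} := IHn (rem x s); rewrite rem_uniq // -ltnS -ss => /(_ sn isT) IH.
rewrite ss /=; case: (size _) dx' IH => [|m] /= dx' IH.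
  by move: dx' IH; rewrite !leqn0 => /eqP-> /eqP->.
by rewrite doubleS -addn2 addnC leq_add // -[2]/(1.*2) leq_double.
Qed.

(** A set grows from one vertex: while it is not all of [s], connectedness yields an edge leaving
    it, and adding the far end raises the degree sum by at least 2. *)
Lemma degree_sum_connected H s : connected H -> uniq s -> vset H = [set` s] ->
  (size s).-1.*2 <= degree_sum H s.
Proof.
move=> [[x0 Hx0] cH] us sE.
have inH x : vset H x <-> x \in s by rewrite sE.
suff grow k : k < size s -> exists t,
    [/\ uniq t, {subset t <= s}, x0 \in t, size t = k.+1 & k.*2 <= degree_sum H t].
  have s0 : 0 < size s by case: (s) (inH x0) => // -[/(_ Hx0)].
  have [|t [ut ts _ st dt]] := grow (size s).-1; first by rewrite prednK.
  rewrite prednK // in st.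
  suff /perm_degree_sum <- : perm_eq t s by [].
  by apply: uniq_perm => //; have [|_] := uniq_min_size ut ts; rewrite ?st.
elim: k => [|k IHk] sk.
  exists [:: x0]; split=> //; last by rewrite inE.
  by move=> y; rewrite inE => /eqP->; apply/inH.
have [t [ut ts x0t st dt]] := IHk (ltnW sk).
have [y ys yt] : exists2 y, y \in s & y \notin t.
  apply: contrapT => ex; suff /(uniq_leq_size us) : {subset s <= t}.
    by rewrite st leqNgt sk.
  by move=> y ys; apply: contraT => yt; case: ex; exists y.
have [p pp lp] := cH x0 y Hx0 ((inH y).2 ys).
rewrite -lp in yt; have [a [b [at_ bt eab]]] := path_crossing pp x0t yt.
exists (b :: t); split=> /=; rewrite ?bt ?st //.
- by move=> z; rewrite inE => /predU1P[->|/ts //]; apply/inH/(edge_vset_r eab).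
- by rewrite inE x0t orbT.
rewrite degree_sum_cons doubleS -addn2 addnC leq_add //.
rewrite -[2]/(1.*2) leq_double -has_count; apply/hasP; exists a => //.
by rewrite edge_sym.
Qed.

Lemma degree_sum_subgraph S H s : subgraph S H -> degree_sum S s <= degree_sum H s.
Proof.
move=> [_ SH]; apply: leq_sum => x _; apply: leq_sum => y _.
by case: (boolP (edge S x y)) => // /SH ->.
Qed.

End Paths.

(** * Edge sums and cardinalities as sums over lists *)

Section Weight.
Variable T : choiceType.
Implicit Types (H : graph T) (s : seq T).

(* Each edge [set x; y] is met by the two ordered pairs (x, y) and (y, x). *)
Lemma fsbig_edge_set_double H s (f : set T -> nat) : uniq s -> vset H `<=` [set` s] ->
  (\big[addn/0]_(e \in edge_set H) f e).*2 =
  \sum_(x <- s) \sum_(y <- s) edge H x y * f [set x; y].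
Proof.
move=> us Hs.
(* [P] lists the adjacent ordered pairs and [g] forgets the order; both sides become the sum of
   [f (g p)] over [P]. *)
pose P := [seq p <- [seq (x, y) | x <- s, y <- s] | edge H p.1 p.2].
pose g (p : T * T) : set T := [set p.1; p.2].
have uP : uniq P by rewrite filter_uniq // allpairs_uniq // => -[? ?] [? ?].
have inP x y : ((x, y) \in P) = edge H x y.
  rewrite mem_filter /=; case: (boolP (edge H x y)) => //= exy.
  by apply/allpairsP; exists (x, y); split=> //; apply: Hs;
    [apply: edge_vset exy|apply: edge_vset_r exy].
have gE x y p : x != y -> (g p == g (x, y)) = (p == (x, y)) || (p == (y, x)).
  move=> xy; apply/eqP/orP => [|[] /eqP-> //]; last by rewrite /g /= setUC.
  case: p => a b; rewrite /g /= => E.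
  have : [set x; y] a by rewrite -E; left.
  have : [set x; y] b by rewrite -E; right.
  have : [set a; b] x by rewrite E; left.
  have : [set a; b] y by rewrite E; right.
  move=> /= [] ya [] xa [] bx [] ax; subst; rewrite ?eqxx ?orbT; auto;
  by rewrite eqxx in xy.
have -> : edge_set H = [set` undup [seq g p | p <- P]].
  apply/seteqP; split=> e /=; rewrite mem_undup.
    by move=> [x [y [exy ->]]]; apply/mapP; exists (x, y); rewrite ?inP.
  by case/mapP=> -[x y]; rewrite inP => exy ->; exists x, y.
rewrite -fsbig_seq ?undup_uniq // -muln2 big_distrl /=.
transitivity (\sum_(p <- P) f (g p)).
  (* Grouping equal images leaves a sum over distinct edges, each with multiplicity 2. *)
  rewrite -[RHS](big_map g xpredT f) -[RHS]big_undup_iterop_count /=.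
  apply: eq_big_seq => e; rewrite mem_undup => /mapP[[x y]]; rewrite inP => exy ->.
  have xy : x != y by apply: contraTneq exy => ->; rewrite edge_irr.
  suff -> : count_mem (g (x, y)) [seq g p | p <- P] = 2 by rewrite /= muln2 addnn.
  rewrite count_map.
  rewrite (eq_count (a2 := predU (pred1 (x, y)) (pred1 (y, x)))); last first.
    by move=> p; rewrite /= gE.
  have := count_predUI (pred1 (x, y)) (pred1 (y, x)) P.
  rewrite (_ : count (predI _ _) P = 0) ?addn0; last first.
    rewrite -(count_pred0 P); apply: eq_count => p /=.
    by apply: contraNF xy => /andP[/eqP-> /eqP[->]].
  by move=> ->; rewrite !count_uniq_mem // !inP (edge_sym H y) exy.
rewrite big_filter big_mkcond big_allpairs /=.
by apply: eq_bigr => x _; apply: eq_bigr => y _; case: edge; rewrite ?mul1n.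
Qed.

Lemma card_fset_set_seq (A : set T) s : finite_set A -> uniq s -> A `<=` [set` s] ->
  #|` fset_set A| = \sum_(v <- s) (v \in A).
Proof.
move=> fA us As; transitivity (size [seq v <- s | v \in A]).
  apply/perm_size/uniq_perm; rewrite ?filter_uniq ?fset_uniq // => v.
  rewrite mem_filter in_fset_set //.
  by case: (boolP (v \in A)) => //= /set_mem /As /= ->.
by rewrite size_filter -sumn_count sumnE big_map.
Qed.

End Weight.

(** * Vertexwise double counting of weights; cliques and clique families *)

Section CliqueTrees.
Variable V : choiceType.
Implicit Types (G : graph V) (S T : graph (set V)) (A K L : set V) (U : seq V).

(** An edge $KL$ weighs one for each $v\in K\cap L$, so after exchanging sums each vertex collects
    the degree sum of the cliques containing it. As [U] bounds the cliques, the intersections are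
    finite and [fset_set] really counts them. *)
Lemma weight_double_count S (s : seq (set V)) U : uniq s -> uniq U ->
  vset S `<=` [set` s] -> (forall K, K \in s -> K `<=` [set` U]) ->
  (weight S).*2 = \sum_(v <- U) degree_sum S [seq K <- s | v \in K].
Proof.
move=> us uU Ss sU; rewrite /weight (fsbig_edge_set_double _ us Ss).
under [RHS]eq_bigr => v _.
  rewrite /degree_sum big_filter big_mkcond /=.
  under eq_bigr => K _ do rewrite big_filter big_mkcond /=.
  over.
rewrite [RHS]exchange_big; apply: eq_big_seq => K Ks.
transitivity (\sum_(L <- s) \sum_(v <- U) (edge S K L * (v \in K `&` L))).
  apply: eq_big_seq => L Ls; rewrite edge_weight_pair -big_distrr /=.
  rewrite (card_fset_set_seq _ uU) //; last by move=> v [/(sU _ Ks)].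
  by apply: sub_finite_set (finite_seq U) => v [/(sU _ Ks)].
rewrite exchange_big; apply: eq_bigr => v _.
case vK: (v \in K); last by apply: big1 => L _; rewrite in_setI vK muln0.
by apply: eq_bigr => L _; rewrite in_setI vK /=; case: (v \in L); rewrite ?muln1 ?muln0.
Qed.

Lemma complete_finite G A : locally_finite G -> complete G A -> finite_set A.
Proof.
move=> lfG [AG cA]; have [[v Av]|/set0P/negP/negPn/eqP->] := pselect (A !=set0); last first.
  exact: finite_set0.
apply: (@sub_finite_set _ _ (v |` [set y | edge G v y])).
  by move=> y Ay; have [->|yv] := eqVneq y v; [left|right; apply: cA; rewrite 1?eq_sym].
by rewrite finite_setU; split; [exact: finite_set1|exact/lfG/AG].
Qed.

(** Complete sets containing a vertex $v$ lie in its finite closed neighbourhood, so one of largest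
    cardinality above [A] exists, and it is maximal. *)
Lemma complete_sub_clique G A : vset G !=set0 -> locally_finite G -> complete G A ->
  exists2 K, cliques G K & A `<=` K.
Proof.
move=> [v0 Gv0] lfG.
(* An empty [A] is replaced by a single vertex, so that a neighbourhood is available. *)
wlog [v Av] : A / A !=set0 => [wl cA|].
  have [A0|/set0P/negP/negPn/eqP->] := pselect (A !=set0); first exact: wl.
  have [||K cK _] := wl [set v0]; [by exists v0| |by exists K].
  by split=> [x -> //|x y -> ->]; rewrite eqxx.
move=> cA; pose N := v |` [set y | edge G v y].
have fN : finite_set N.
  by rewrite finite_setU; split; [exact: finite_set1|exact/lfG/cA.1].
have subN L : complete G L -> A `<=` L -> L `<=` N.
  move=> [LG cL] AL y Ly; have [->|yv] := eqVneq y v; first by left.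
  by right; apply: cL => //; [apply: AL|rewrite eq_sym].
have finL L : complete G L -> finite_set L by apply: complete_finite.
pose P n := `[< exists L, [/\ complete G L, A `<=` L & #|` fset_set L| = n] >].
have exP : exists n, P n by exists #|` fset_set A|; apply/asboolP; exists A; split.
have ubP n : P n -> n <= #|` fset_set N|.
  move=> /asboolP[L [cL AL <-]]; apply: fsubset_leq_card.
  by rewrite -fset_set_sub //; [exact: subN|exact: finL].
case: (ex_maxnP exP ubP) => n /asboolP[K [cK AK <-]] maxK.
exists K => //; split=> // L cL KL; apply/esym/(fset_set_inj (finL _ cK) (finL _ cL)).
apply/eqP; rewrite eqEfcard; apply/andP; split.
  by rewrite -fset_set_sub //; exact: finL.
apply: maxK; apply/asboolP; exists L; split=> //.
exact: subset_trans KL.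
Qed.

(** Every member lies in the closed neighbourhood of one fixed vertex of [A], a finite set with
    finitely many subsets. *)
Lemma finite_clique_family G A : locally_finite G -> A !=set0 -> A `<=` vset G ->
  finite_set (clique_family G A).
Proof.
move=> lfG [v Av] AG; pose N := v |` [set y | edge G v y].
have fN : finite_set N.
  by rewrite finite_setU; split; [exact: finite_set1|exact/lfG/AG].
pose pN := [set` fpowerset (fset_set N)].
apply: (@sub_finite_set _ _ [set [set` X] | X in pN]); last first.
  exact/finite_image/finite_fset.
move=> K [[cK _] AK].
have KN : K `<=` N.
  move=> y Ky; have [->|yv] := eqVneq y v; first by left.
  by right; apply: cK.2 => //; [apply: AK|rewrite eq_sym].
have fK := complete_finite lfG cK.
exists (fset_set K); last exact: fset_setK.
by rewrite /pN /= fpowersetE -fset_set_sub.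
Qed.

(** Lets the connectivity of families in a clique tree be applied to the members of a family that
    pass through one vertex. *)
Lemma clique_family_setU1 G A v :
  clique_family G (v |` A) = clique_family G A `&` [set K | K v].
Proof.
apply/seteqP; split=> K /= => [[cK vAK]|[[cK AK] Kv]].
  by split; [split=> // x Ax; apply: vAK; right|apply: vAK; left].
by split=> // x [->|/AK].
Qed.

(* By uniqueness of paths, the path of [T] between two cliques of the family
   stays in the subtree of every vertex of [A]. *)
Lemma clique_tree_family_connected G T A : clique_tree G T -> A `<=` vset G ->
  clique_family G A !=set0 -> connected (induced T (clique_family G A)).
Proof.
move=> [[_ TG [cT acT]] trT] AG [K0 FK0]; split.
  by exists K0; split=> //; rewrite TG; apply: FK0.1.
move=> K L [TK FK] [TL FL].
have [p0 pp0 lp0] := cT.2 K L TK TL.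
case/shortenP: pp0 lp0 => p pp up _ lp.
exists p => //; apply: induced_path => //; apply/allP => M Mp; rewrite inE.
have TM : cliques G M.
  rewrite -[cliques G]TG; move: Mp; rewrite inE => /predU1P[-> //|Mp].
  case/splitPr: Mp pp => p1 p2; rewrite cat_path /= => /and3P[_ + _].
  exact: edge_vset_r.
split=> // v Av; have [[_ cv] _] := trT v (AG v Av).
have vK : K \in [set K | cliques G K /\ K v] by rewrite inE; split; [apply: FK.1|apply: FK.2].
have [||q0 pq0 lq0] := cv K L.
- by split=> //; apply/set_mem.
- by split=> //; split; [apply: FL.1|apply: FL.2].
case/shortenP: pq0 lq0 => q pq uq _ lq.
have [pq' /(_ vK) /allP qv] := path_induced pq.
have pE := acyclic_path_inj acT pp pq' up uq (etrans lp (esym lq)).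
by have := qv M; rewrite -pE Mp => /(_ isT) /set_mem[].
Qed.

End CliqueTrees.

(** * Clique trees and weight-maximal trees on finite clique families *)

Theorem theorem4p4 (V : choiceType) (G : graph V) (T : graph (set V))
    (Gconn : connected G) (Glf : locally_finite G) (Gchordal : chordal G)
    (Tspan : spanning_tree (clique_graph G) T) :
  clique_tree G T <->
  (forall F : set (set V), clique_families G F -> finite_set F ->
    argmax [set S | spanning_tree (induced (clique_graph G) F) S]
           (@weight V) (induced T F)).
Proof.
have [[_ TsubE] TG [_ acT]] := Tspan.
split=> [ctT F [C cC ->] fF|opt]; last first.
  split=> // v Gv.
  have -> : [set K | cliques G K /\ K v] = clique_family G [set v].
    by apply/seteqP; split=> K [cK vK]; split=> //; [move=> _ ->|apply: vK].
  have cv : complete G [set v] by split=> [x -> //|x y -> ->]; rewrite eqxx.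
  have fv : finite_set (clique_family G [set v]).
    by apply: finite_clique_family cv.1 => //; exists v.
  by have [[_ _ trTv] _] := opt _ (ex_intro2 _ _ _ cv erefl) fv.
(* A tree must have a vertex; for empty [C] the clique is found through a vertex of [G]. *)
have F0 : clique_family G C !=set0.
  by have [K cK CK] := complete_sub_clique Gconn.1 Glf cC; exists K.
have acF A : acyclic (induced T A).
  by apply: acyclic_subgraph acT; split=> [K []|K L /and3P[]].
split.
  split.
  - split=> [K [TK FK]|K L /and3P[eKL KF LF]]; first by split=> //; move: TK; rewrite TG.
    by apply/and3P; split=> //; apply: TsubE.
  - by rewrite /= TG.
  - by split=> //; apply: clique_tree_family_connected cC.1 F0.
move=> S [_ SF [_ acS]]; rewrite -leq_double.
pose s : seq (set V) := fset_set (clique_family G C).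
have us : uniq s := fset_uniq _.
have sE : [set` s] = clique_family G C := fset_setK fF.
have finK K : K \in s -> finite_set K.
  move=> Ks; apply: (complete_finite Glf).
  by have : [set` s] K by []; rewrite sE => -[[]].
pose U := undup (flatten [seq (fset_set K : seq V) | K <- s]).
have sU K : K \in s -> K `<=` [set` U].
  move=> Ks v Kv; rewrite /= mem_undup; apply/flattenP; exists (fset_set K : seq V).
    exact: map_f.
  by rewrite in_fset_set ?inE //; apply: finK.
rewrite (weight_double_count us (undup_uniq _) _ sU); last by rewrite SF sE => K [].
rewrite (weight_double_count us (undup_uniq _) _ sU); last by rewrite sE => K [].
(* Both doubled weights are split over the same list [U], so it suffices to compare them at each
   [v]; the common value between them is [(size sv).-1.*2]. *)
apply: leq_sum => v _; set sv := [seq K <- s | v \in K].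
have usv : uniq sv by rewrite filter_uniq.
apply: leq_trans (degree_sum_acyclic acS usv) _.
have svE : [set` sv] = clique_family G (v |` C).
  rewrite clique_family_setU1 -sE; apply/seteqP; split=> K /=; rewrite mem_filter.
    by case/andP=> /set_mem.
  by move=> [-> Kv]; rewrite andbT inE.
(* Without cliques through [v] the truncated predecessor makes the bound 0; otherwise the first
   clique of [sv] shows that the smaller family is nonempty. *)
have [->|] := eqVneq sv [::]; first by [].
case def_sv: sv => [//|K0 s0] _; rewrite -def_sv.
have K0v : clique_family G (v |` C) K0 by rewrite -svE /= def_sv mem_head.
(* The lower bound needs a graph whose vertex set is exactly [sv], hence the passage through the
   subgraph of [T] induced on the smaller family. *)
apply: (@leq_trans (degree_sum (induced T (clique_family G (v |` C))) sv)).
  apply: degree_sum_connected => //.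
    apply: clique_tree_family_connected => //; last by exists K0.
    (* [K0] is complete and contains [v] and [C], so all of these are vertices of [G]. *)
    by apply: subset_trans K0v.2 _; apply: K0v.1.1.1.
  by rewrite svE /= TG; apply/seteqP; split=> [K []|K FK] //; split=> //; apply: FK.1.
have subF : clique_family G (v |` C) `<=` clique_family G C.
  by rewrite clique_family_setU1; apply: subIsetl.
apply: degree_sum_subgraph; split=> [K [TK /subF FK] //|K L].
case/and3P=> eKL /set_mem/subF KF /set_mem/subF LF.
by apply/and3P; split=> //; apply: mem_set.
Qed.
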